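(* $$1.22<\sqrt[9]{6}\leq \lim_{n\to\infty} \zeta_2(n) \leq \sqrt[5]{3}<1.246.$$
   Context: All graphs are finite and simple. For a positive integer $k$, a $k$-dominating independent set ($k$-DIS) of a graph $G$ is a set $D\subseteq V(G)$ that induces no edge and such that every vertex $v\in V(G)\setminus D$ satisfies $|N(v)\cap D|\geq k$, where $N(v)$ is the set of neighbors of $v$. Let $\mathrm{mi}_k(n)$ denote the maximum number of $k$-DISes in a graph on $n$ vertices, and let $\zeta_k(n):=\sqrt[n]{\mathrm{mi}_k(n)}$. The limit $\lim_{n\to\infty}\zeta_k(n)$ exists for every $k$. *)

(* Defs.v *)
From HB Require Import structures.
From mathcomp Require Import all_boot all_order all_algebra.
From mathcomp Require Import all_classical all_reals all_analysis.

Set Implicit Arguments.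
Unset Strict Implicit.
Unset Printing Implicit Defensive.

Import Order.TTheory GRing.Theory Num.Theory.
Import numFieldNormedType.Exports.

Local Open Scope ring_scope.

Definition simple_graph (T : finType) (e : rel T) : bool :=
  [forall x, ~~ e x x] && [forall x, forall y, e x y == e y x].

Definition neighbors (T : finType) (e : rel T) (v : T) : {set T} :=
  [set u | e v u].

Definition independent (T : finType) (e : rel T) (D : {set T}) : bool :=
  [forall x in D, forall y in D, ~~ e x y].

Definition k_dominating (T : finType) (e : rel T) (k : nat) (D : {set T}) :
    bool :=
  [forall v, (v \notin D) ==> (k <= #|neighbors e v :&: D|)%N].

Definition kDIS (T : finType) (e : rel T) (k : nat) (D : {set T}) : bool :=
  independent e D && k_dominating e k D.

Definition num_kDIS (T : finType) (e : rel T) (k : nat) : nat :=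
  #|[set D : {set T} | kDIS e k D]|.

(* A set of ordered pairs encodes a relation by a point of a finite type, so   *)
(* that \max_ can range over all simple graphs with vertex set 'I_n.           *)
Definition rel_of_pairs (T : finType) (E : {set T * T}) : rel T :=
  fun x y => (x, y) \in E.

Definition mi (k n : nat) : nat :=
  (\max_(E : {set 'I_n * 'I_n} | simple_graph (rel_of_pairs E))
     num_kDIS (rel_of_pairs E) k)%N.

(* The real n-th root of a nonnegative x, for 0 < n. *)
Definition nth_root (R : realType) (n : nat) (x : R) : R := x `^ (n%:R^-1).

(* The value at n = 0 is irrelevant to the limit. *)
Definition zeta (R : realType) (k n : nat) : R := nth_root n (mi k n)%:R.

(* Main.v *)
Require Import Defs.
From HB Require Import structures.
From mathcomp Require Import all_boot all_order all_fingroup all_algebra.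
From mathcomp Require Import all_classical all_reals all_analysis.
From mathcomp Require Import ring lra.
Import Order.TTheory GRing.Theory Num.Theory.
Import numFieldNormedType.Exports.

Set Implicit Arguments.
Unset Strict Implicit.
Unset Printing Implicit Defensive.

Local Open Scope ring_scope.

(** Deleting a vertex [u] of a [k]-DIS [D] together with all its neighbours
leaves a [k]-DIS [D :\ u] of the remaining graph: a vertex that is not adjacent
to [u] keeps all its neighbours in [D].  So the [k]-DISes through [u] inject into
those of [G - N[u]], and the upper bound comes from counting with this.

Upper bound.  Let [x = 3^(1/5)]; then every graph on [n] vertices has at most
[x^n] 2-DISes ([weight_le1]).  Write [g u] for the number of 2-DISes through [u].
If a 2-DIS avoids [v], it has two vertices in [N(v)], hence
[2 * #DIS <= 2 * g v + \sum_(u in N(v)) g u] ([double_count]).  If [v] has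
minimum degree [d], each [g u] is at most [x^(n - d - 1)] by induction, so the
number of 2-DISes is at most [(1 + d/2) x^-(d+1) x^n].  For [d >= 4] the factor is
at most 1, with equality at [d = 4]: this is where [3^(1/5)] comes from.  Two
ranges of degrees need more care.
- [d <= 2] ([weight_low_degree]).  A vertex of degree at most 1 lies in every
  2-DIS.  A vertex [v] of degree 2 either lies in [D] or has both neighbours in
  [D], and the latter choice deletes at least four vertices.  Either way a factor
  [x^-3 + x^-4 < 1] is gained.
- [d = 3] ([weight_cubic]).  If two neighbours of [v] are adjacent, then every
  2-DIS contains [v] or the third neighbour.  If some neighbour has degree at
  least 4, its term in the double count is small enough.  Failing both for every
  vertex of degree 3, deleting [N[u]] for any [u] of degree 3 leaves a vertex of
  degree at most 2, and the gain of the previous case applies to every term.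

Limit and lower bound.  The [k]-DISes of a disjoint union are the unions of
[k]-DISes of its parts, so [mi k] is supermultiplicative and Fekete's lemma
([fekete]) gives the limit as the supremum of [zeta k n] over [n > 0].  In the
rook graph on a [3 x 3] board the six graphs of permutations are 2-DISes, so the
supremum is at least [6^(1/9)]. *)

(** * Dominating independent sets of induced subgraphs *)

Section InducedSubgraphs.

(* Lemma names shared with classical sets refer to finite sets in this section. *)
Import mathcomp.boot.fintype mathcomp.boot.finset.

Context (T : finType) (e : rel T) (e_simple : simple_graph e).
Implicit Types (S A D : {set T}) (u v w : T).

Lemma edge_sym u v : e u v = e v u.
Proof. by case/andP: e_simple => _ /forallP/(_ u)/forallP/(_ v)/eqP. Qed.

Lemma edge_irr v : e v v = false.
Proof. by case/andP: e_simple => /forallP/(_ v)/negbTE. Qed.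

(** The [k]-DISes of the subgraph induced on [S], kept as subsets of the ambient
vertex type, so that the induction on vertex deletions never changes graph. *)
Definition dis_in (k : nat) S : {set {set T}} :=
  [set D : {set T} | [&& D \subset S, independent e D &
     [forall v in S :\: D, k <= #|neighbors e v :&: D|]%N]].

Lemma dis_inP k S D :
  reflect [/\ D \subset S, forall x y, x \in D -> y \in D -> ~~ e x y
            & forall v, v \in S -> v \notin D -> (k <= #|neighbors e v :&: D|)%N]
          (D \in dis_in k S).
Proof.
rewrite inE; apply: (iffP and3P) => -[DS indD domD]; split => //.
- by move=> x y xD yD; move/forall_inP/(_ x xD)/forall_inP: indD; apply.
- by move=> v vS vD; move/forall_inP: domD; apply; rewrite in_setD vD.
- by apply/forall_inP => x xD; apply/forall_inP => y yD; apply: indD.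
- by apply/forall_inP => v; rewrite in_setD => /andP[vD vS]; apply: domD.
Qed.

Lemma num_kDIS_dis_in k : num_kDIS e k = #|dis_in k [set: T]|.
Proof.
apply: eq_card => D; rewrite !inE /kDIS subsetT; congr (_ && _).
by apply: eq_forallb => v; rewrite !inE andbT.
Qed.

Definition closed_nbhd A : {set T} := A :|: \bigcup_(a in A) neighbors e a.

Lemma in_closed_nbhd A w :
  (w \in closed_nbhd A) = (w \in A) || [exists a in A, e a w].
Proof.
rewrite in_setU; congr (_ || _); apply/bigcupP/exists_inP => -[a aA].
  by rewrite inE; exists a.
by exists a => //; rewrite inE.
Qed.

Lemma mem_closed_nbhd A a w : a \in A -> e a w -> w \in closed_nbhd A.
Proof.
by move=> aA eaw; rewrite in_closed_nbhd; apply/orP; right; apply/exists_inP; exists a.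
Qed.

Lemma sub_closed_nbhd A : A \subset closed_nbhd A.
Proof. exact: subsetUl. Qed.

(** The map [D |-> D :\: A] is injective on the sets containing [A], and it yields
[k]-DISes of the graph left after deleting [A] and its neighbours: none of the
surviving vertices is adjacent to the part of [D] that is deleted. *)
Lemma card_dis_in_containing k S A :
  (#|[set D in dis_in k S | A \subset D]| <= #|dis_in k (S :\: closed_nbhd A)|)%N.
Proof.
rewrite -(@card_in_imset _ _ (fun D => D :\: A)); last first.
  move=> D1 D2; rewrite !inE => /andP[_ AD1] /andP[_ AD2] eqD.
  by rewrite -(setID D1 A) -(setID D2 A) (setIidPr AD1) (setIidPr AD2) eqD.
apply/subset_leq_card/subsetP => _ /imsetP[D + ->].
rewrite inE => /andP[/dis_inP[/subsetP DS indD domD] /subsetP AD].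
have nA v : v \notin closed_nbhd A -> forall a, a \in A -> ~~ e a v.
  by move=> vA a aA; apply: contra vA; apply: mem_closed_nbhd.
apply/dis_inP; split.
- apply/subsetP => w; rewrite !in_setD => /andP[wA wD].
  rewrite DS // andbT in_closed_nbhd (negbTE wA) /=.
  by apply/exists_inP => -[a /AD aD]; apply/negP/indD.
- by move=> x y; rewrite !in_setD => /andP[_ xD] /andP[_ yD]; apply: indD.
- move=> v; rewrite in_setD => /andP[vA vS].
  have vnA : v \notin A by apply: contra vA; apply/subsetP/sub_closed_nbhd.
  rewrite in_setD vnA /= => vD.
  suff -> : neighbors e v :&: (D :\: A) = neighbors e v :&: D by apply: domD.
  apply/setP => w; rewrite !inE; case evw: (e v w) => //=.
  case wA: (w \in A) => //=.
  by move: (nA v vA w wA); rewrite edge_sym evw.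
Qed.

Lemma dis_in_vertex k S v D :
  v \in S -> D \in dis_in k S ->
  v \in D \/ (k <= #|neighbors e v :&: S :&: D|)%N.
Proof.
move=> vS /dis_inP[/setIidPr DS _ domD].
case: (boolP (v \in D)) => [|vD]; [by left | right].
by rewrite -setIA DS; apply: domD.
Qed.

(** Each [D] is counted at least [k] times on the right: by the first term if [v \in D],
and otherwise through at least [k] members of [D] adjacent to [v]. *)
Lemma double_count k S v :
  v \in S ->
  (k * #|dis_in k S| <=
   k * #|dis_in k (S :\: closed_nbhd [set v])|
   + \sum_(u in neighbors e v :&: S) #|dis_in k (S :\: closed_nbhd [set u])|)%N.
Proof.
move=> vS.
have cont u : (\sum_(D in dis_in k S) (u \in D) <= #|dis_in k (S :\: closed_nbhd [set u])|)%N.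
  apply: leq_trans (card_dis_in_containing k S [set u]).
  rewrite -sum1_card big_mkcond [leqRHS]big_mkcond /=.
  apply: leq_sum => D _; rewrite [D \in [set _ in _ | _]]inE sub1set.
  by case: (D \in _); case: (u \in D).
apply: (@leq_trans (k * (\sum_(D in dis_in k S) (v \in D))
    + \sum_(u in neighbors e v :&: S) \sum_(D in dis_in k S) (u \in D))); last first.
  by apply: leq_add; [rewrite leq_mul2l cont orbT | apply: leq_sum].
rewrite exchange_big /= big_distrr /= -big_split /= mulnC -sum_nat_const.
apply: leq_sum => D DD; case: (dis_in_vertex vS DD) => [->|]; first by rewrite muln1 leq_addr.
move=> /leq_trans -> //; apply: leq_trans (leq_addl _ _).
rewrite -sum1_card big_mkcond [leqRHS]big_mkcond /=.
by apply: leq_sum => u _; rewrite !inE; case: (e v u); case: (u \in S); case: (u \in D).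
Qed.

End InducedSubgraphs.

(** * Inequalities for the inverse of the fifth root of 3 *)

Section GrowthRate.

Context (R : realFieldType) (y : R) (y_gt0 : 0 < y) (y5 : 3 * y ^+ 5 = 1).

(** The upper bound is tight enough for [y^2 + y^3 <= 6/5], which [cubic_numeric]
needs; the lower bound is what makes [y^4 = 1 / (3 y)] at most 5/12. *)
Lemma inv_growth_bounds : 4 / 5 <= y /\ y <= 807 / 1000.
Proof.
have lt5 (a b : R) : 0 < a -> 0 < b -> a < b -> a ^+ 5 < b ^+ 5.
  by move=> a_gt0 b_gt0; rewrite ltr_pXn2r ?nnegrE ?ltW.
have d5 : 0 < 4 / 5 :> R by lra.
have d807 : 0 < 807 / 1000 :> R by lra.
have := y5; rewrite !leNgt; split; apply/negP => /lt5.
  by move=> /(_ y_gt0 d5); lra.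
by move=> /(_ d807 y_gt0); lra.
Qed.

Lemma inv_growth_exp_anti m n : (m <= n)%N -> y ^+ n <= y ^+ m.
Proof.
have [y_ge y_le] := inv_growth_bounds => mn.
by apply: ler_wiXn2l => //; [rewrite ltW|lra].
Qed.

Lemma inv_growth_powers :
  [/\ 64 / 100 <= y ^+ 2 /\ y ^+ 2 <= 652 / 1000,
      512 / 1000 <= y ^+ 3 /\ y ^+ 3 <= 527 / 1000
    & 0 <= y ^+ 4 /\ y ^+ 4 <= 5 / 12].
Proof.
have [y_ge y_le] := inv_growth_bounds.
have [y2_ge y2_le] : 64 / 100 <= y ^+ 2 /\ y ^+ 2 <= 652 / 1000.
  by rewrite expr2; split; nra.
have [y3_ge y3_le] : 512 / 1000 <= y ^+ 3 /\ y ^+ 3 <= 527 / 1000.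
  by rewrite exprS; split; nra.
do 2!split => //; first by rewrite exprn_ge0 ?ltW.
have : 3 * (y * y ^+ 4) = 1 by rewrite -exprS.
have : 0 <= y ^+ 4 by rewrite exprn_ge0 ?ltW.
move: (y ^+ 4) => z; nra.
Qed.

Lemma low_degree_numeric : y <= y ^+ 3 + y ^+ 4 /\ y ^+ 3 + y ^+ 4 <= 1.
Proof.
have [y_ge y_le] := inv_growth_bounds.
have [[y2_ge y2_le] [y3_ge y3_le] [y4_ge y4_le]] := inv_growth_powers.
split; last by lra.
have -> : y ^+ 3 + y ^+ 4 = y * (y ^+ 2 + y ^+ 3) by ring.
by rewrite -[leLHS]mulr1 ler_pM2l //; lra.
Qed.

Lemma cubic_numeric : 5 * (y ^+ 4 * (y ^+ 3 + y ^+ 4)) <= 2.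
Proof.
have [[y2_ge y2_le] [y3_ge y3_le] [y4_ge y4_le]] := inv_growth_powers.
have -> : 5 * (y ^+ 4 * (y ^+ 3 + y ^+ 4)) = 5 / 3 * (3 * y ^+ 5) * (y ^+ 2 + y ^+ 3).
  by field.
by rewrite y5; lra.
Qed.

(** Equality holds at [d = 4]; from there on, raising [d] by one multiplies the left
side by [y (d + 3) / (d + 2) <= 7 y / 6 < 1]. *)
Lemma high_degree_numeric d : (4 <= d)%N -> d.+2%:R * y ^+ d.+1 <= 2.
Proof.
have [y_ge y_le] := inv_growth_bounds.
move=> /subnK <-; elim: (d - 4)%N => [|n IHn].
  have -> : (0 + 4).+2%:R = 2 * 3 :> R by rewrite -natrM.
  by rewrite -mulrA y5 mulr1.
apply: le_trans IHn; rewrite addSn [y ^+ _]exprS mulrA ler_pM2r ?exprn_gt0 //.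
rewrite -[(n + 4).+3]addn3 -[(n + 4).+2]addn2 !natrD.
by move: (ler0n R n); nra.
Qed.

End GrowthRate.

(** * At most 3^(n/5) 2-dominating independent sets *)

Section UpperBound.

Import mathcomp.boot.fintype mathcomp.boot.finset.

Context (R : realFieldType) (y : R) (y_gt0 : 0 < y) (y5 : 3 * y ^+ 5 = 1).
Context (T : finType) (e : rel T) (e_simple : simple_graph e).
Implicit Types (S A B D : {set T}) (u v w : T).

Local Notation deg S v := #|neighbors e v :&: S|.
Local Notation dis S := (dis_in e 2 S).

(** The number of 2-DISes of [S] divided by the claimed bound [3^(#|S| / 5)]. *)
Definition weight S : R := #|dis S|%:R * y ^+ #|S|.

Definition smaller_weights_le1 S := forall S', (#|S'| < #|S|)%N -> weight S' <= 1.

(** Contribution to [weight S] of the 2-DISes containing [A], as bounded by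
[card_dis_in_containing]. *)
Definition branch S A : R := #|dis (S :\: closed_nbhd e A)|%:R * y ^+ #|S|.

Lemma branchE S A :
  branch S A = weight (S :\: closed_nbhd e A) * y ^+ #|S :&: closed_nbhd e A|.
Proof.
by rewrite /branch /weight -mulrA -exprD [(#|_ :\: _| + _)%N]addnC cardsID.
Qed.

Lemma branch_le S A m :
  smaller_weights_le1 S -> (0 < m <= #|S :&: closed_nbhd e A|)%N -> branch S A <= y ^+ m.
Proof.
move=> IH /andP[m_gt0 mA]; rewrite branchE.
apply: le_trans (inv_growth_exp_anti y_gt0 y5 mA).
rewrite ler_piMl ?exprn_ge0 ?(ltW y_gt0) //; apply: IH.
by rewrite -(cardsID (closed_nbhd e A) S) -[ltnLHS]add0n ltn_add2r (leq_trans m_gt0).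
Qed.

Lemma card_closed_nbhd1 S v :
  v \in S -> #|S :&: closed_nbhd e [set v]| = (deg S v).+1.
Proof.
move=> vS; rewrite /closed_nbhd big_set1 setIUr setIC; have /setIidPl -> : [set v] \subset S.
  by rewrite sub1set.
by rewrite cardsU1 [S :&: _]setIC !inE edge_irr.
Qed.

Lemma branch1_le S v m :
  smaller_weights_le1 S -> v \in S -> (m <= deg S v)%N -> branch S [set v] <= y ^+ m.+1.
Proof. by move=> IH vS mv; apply: branch_le; rewrite // card_closed_nbhd1. Qed.

Lemma weight_le_branch S A :
  (forall D, D \in dis S -> A \subset D) -> weight S <= branch S A.
Proof.
move=> AD; rewrite ler_pM2r ?exprn_gt0 // ler_nat.
apply: leq_trans (card_dis_in_containing e_simple 2 S A).
by apply/subset_leq_card/subsetP => D DD; rewrite inE DD AD.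
Qed.

Lemma weight_le_branch2 S A B :
  (forall D, D \in dis S -> A \subset D \/ B \subset D) ->
  weight S <= branch S A + branch S B.
Proof.
move=> ABD; rewrite -mulrDl ler_pM2r ?exprn_gt0 // -natrD ler_nat.
apply: leq_trans (leq_add (card_dis_in_containing e_simple 2 S A)
                          (card_dis_in_containing e_simple 2 S B)).
apply: leq_trans (leq_card_setU _ _).
apply/subset_leq_card/subsetP => D DD.
by rewrite in_setU ![D \in [set _ in _ | _]]inE DD; apply/orP/ABD.
Qed.

Lemma weight_double_count S v :
  v \in S ->
  2 * weight S <= 2 * branch S [set v]
                  + \sum_(u in neighbors e v :&: S) branch S [set u].
Proof.
move=> vS; rewrite /weight /branch -mulr_suml !mulrA -mulrDl ler_pM2r ?exprn_gt0 //.
by rewrite -natr_sum -!natrM -natrD ler_nat; apply: double_count.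
Qed.


(** The strict gain over [weight S <= 1] is what [weight_cubic] feeds on. *)
Lemma weight_low_degree S v :
  smaller_weights_le1 S -> v \in S -> (deg S v <= 2)%N -> weight S <= y ^+ 3 + y ^+ 4.
Proof.
move=> IH vS dv2; have [y_le _] := low_degree_numeric y_gt0 y5.
have y_ge0 : 0 <= y by apply: ltW.
(* A vertex of degree at most 1 cannot have two neighbours in [D]. *)
case: (boolP [exists w in S, deg S w <= 1]%N) => [/exists_inP[w wS dw]|].
  apply: le_trans y_le; apply: (@le_trans _ _ (branch S [set w])).
    apply: weight_le_branch => D /(dis_in_vertex wS)[|dwD]; first by rewrite sub1set.
    by move: (leq_trans dwD (leq_trans (subset_leq_card (subsetIl _ _)) dw)).
  by rewrite -[leRHS]expr1; apply: branch1_le.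
rewrite negb_exists_in => /forall_inP min2.
have {min2} deg_ge2 w : w \in S -> (2 <= deg S w)%N by move=> /min2; rewrite -ltnNge.
have dv : deg S v == 2 by rewrite eqn_leq dv2 deg_ge2.
have /cards2P[a [b [nab Nv]]] := dv.
have [aN bN] : a \in neighbors e v :&: S /\ b \in neighbors e v :&: S.
  by rewrite Nv !inE !eqxx orbT.
move: (aN) (bN); rewrite !inE => /andP[eva aS] /andP[evb bS].
have cover D : D \in dis S -> [set v] \subset D \/ [set a; b] \subset D.
  move=> /(dis_in_vertex vS)[|]; rewrite ?sub1set; first by left.
  rewrite Nv => abD; right; apply/setIidPl/eqP.
  by rewrite eqEcard subsetIl cards2 nab.
have branch_v : branch S [set v] <= y ^+ 3 by apply: branch1_le; rewrite ?(eqP dv).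
(* If [a] and [b] are adjacent, no independent set contains both. *)
case eab: (e a b).
  apply: (@le_trans _ _ (branch S [set v])); last first.
    by apply: le_trans branch_v _; rewrite lerDl exprn_ge0.
  apply: weight_le_branch => D DD; case: (cover D DD) => // /subsetP abD.
  move: DD => /dis_inP[_ indD _].
  by have := indD a b (abD _ (set21 _ _)) (abD _ (set22 _ _)); rewrite eab.
apply: le_trans (weight_le_branch2 cover) _; apply: lerD => //.
apply: branch_le => //=.
(* Besides [v], [a] and [b], the second neighbour of [a] is deleted too. *)
have [w wN wv] : exists2 w, w \in neighbors e a :&: S & w != v.
  have := deg_ge2 a aS; rewrite (cardsD1 v) !inE (edge_sym e_simple) eva vS /= add1n ltnS.
  by move=> /card_gt0P[w]; rewrite !inE => /andP[wv wN]; exists w; rewrite ?inE.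
move: wN; rewrite !inE => /andP[eaw wS].
have quad : uniq [:: v; a; b; w].
  have neq p q : e p q -> p != q by apply: contraTneq => ->; rewrite edge_irr.
  rewrite /= !inE !negb_or (neq v a) // (neq v b) // nab (neq a w) // eq_sym wv.
  by rewrite /= andbT; apply: contraFneq eab => ->.
have -> : 4%N = #|[:: v; a; b; w]| by rewrite (card_uniqP quad).
apply/subset_leq_card/subsetP => z; rewrite !in_cons in_nil orbF in_setI.
have mem c p : c \in [set a; b] -> e c p -> p \in closed_nbhd e [set a; b].
  exact: mem_closed_nbhd.
have sub := subsetP (sub_closed_nbhd e [set a; b]).
case/or4P => /eqP ->; rewrite ?vS ?aS ?bS ?wS.
- by rewrite (mem a) ?set21 // (edge_sym e_simple).
- by rewrite sub ?set21.
- by rewrite sub ?set22.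
- by rewrite (mem a) ?set21.
Qed.

(** The double count alone fails here: it gives [5/2 y^4 > 1].  Whatever the
neighbourhoods of the vertices of degree 3 look like, something can be gained. *)
Lemma weight_cubic S v :
  smaller_weights_le1 S -> (forall u, u \in S -> 3 <= deg S u)%N ->
  v \in S -> deg S v = 3%N -> weight S <= 1.
Proof.
move=> IH min3 vS dv.
have [_ _ [y4_ge0 y4_le]] := inv_growth_powers y_gt0 y5.
have branch4 u : u \in S -> branch S [set u] <= y ^+ 4.
  by move=> uS; apply: branch1_le => //; apply: min3.
(* A vertex [u] of degree 3 with adjacent neighbours [a] and [b]: a 2-DIS avoiding
   [u] contains at most one of [a], [b], hence the third neighbour [c]. *)
case: (boolP [exists u in S, (deg S u == 3) && [exists a in neighbors e u :&: S,
        exists b in neighbors e u :&: S, e a b]]).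
  case/exists_inP => u uS /andP[/eqP du /exists_inP[a aN /exists_inP[b bN eab]]].
  have nab : a != b by apply: contraTneq eab => ->; rewrite edge_irr.
  have : #|neighbors e u :&: S :\: [set a; b]| == 1.
    rewrite cardsDS ?du ?cards2 ?nab //.
    by apply/subsetP => z /set2P[] ->.
  case/cards1P => c Nc.
  have cS : c \in S.
    by have := set11 c; rewrite -Nc in_setD in_setI => /and3P[].
  apply: (@le_trans _ _ (branch S [set u] + branch S [set c])).
    apply: weight_le_branch2 => D DD; rewrite !sub1set.
    case: (dis_in_vertex uS DD) => [|two]; [by left | right].
    apply: contraLR two => cD; rewrite -ltnNge ltnNge; apply/negP => two.
    have ND : neighbors e u :&: S :&: D \subset [set a; b].
      apply/subsetP => z; rewrite in_setI => /andP[zN zD].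
      apply: contraNT cD => zab; have : z \in [set c] by rewrite -Nc in_setD zab.
      by rewrite inE => /eqP <-.
    have : neighbors e u :&: S :&: D == [set a; b] by rewrite eqEcard ND cards2 nab.
    move=> /eqP NDE; move: DD => /dis_inP[_ indD _].
    have inD z : z \in [set a; b] -> z \in D by rewrite -NDE in_setI => /andP[].
    by have := indD a b (inD _ (set21 _ _)) (inD _ (set22 _ _)); rewrite eab.
  by have := branch4 u uS; have := branch4 c cS; lra.
rewrite negb_exists_in => /forall_inP notriangle.
have {notriangle} indN u a b : u \in S -> deg S u = 3%N ->
    a \in neighbors e u :&: S -> b \in neighbors e u :&: S -> ~~ e a b.
  move=> uS du aN bN; apply/negP => eab.
  have /negP[] := notriangle u uS; rewrite du eqxx /=.
  by apply/exists_inP; exists a => //; apply/exists_inP; exists b.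
(* A vertex of degree 3 with a neighbour of larger degree: [4 y^4 + y^5 <= 2]. *)
case: (boolP [exists u in S, (deg S u == 3) && [exists a in neighbors e u :&: S, deg S a >= 4]%N]).
  case/exists_inP => u uS /andP[/eqP du /exists_inP[a aN da]].
  have := weight_double_count uS; rewrite (big_setD1 a) //=.
  have aS : a \in S by move: aN; rewrite in_setI => /andP[].
  have : \sum_(b in (neighbors e u :&: S) :\ a) branch S [set b] <= y ^+ 4 *+ 2.
    have two : #|(neighbors e u :&: S) :\ a| = 2%N.
      by have := cardsD1 a (neighbors e u :&: S); rewrite aN du => -[].
    rewrite -[X in _ *+ X]two -sumr_const; apply: ler_sum => b.
    by rewrite !inE => /and3P[_ _ bS]; apply: branch4.
  have : branch S [set a] <= y ^+ 5 by apply: branch1_le.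
  have := y5; have := branch4 u uS; rewrite mulr2n; lra.
rewrite negb_exists_in => /forall_inP nohigh.
have {nohigh} cubicN u a : u \in S -> deg S u = 3%N -> a \in neighbors e u :&: S ->
    deg S a = 3%N.
  move=> uS du aN; have aS : a \in S by move: aN; rewrite in_setI => /andP[].
  have := nohigh u uS; rewrite du eqxx /= negb_exists_in => /forall_inP/(_ a aN).
  by rewrite -ltnNge ltnS => da; apply/eqP; rewrite eqn_leq da min3.
(* A neighbour [a] of [u] has another neighbour [w], which is not adjacent to [u].
   All of them have degree 3, and [w] loses [a] when [N[u]] is deleted. *)
have branch_cubic u : u \in S -> deg S u = 3%N ->
    branch S [set u] <= y ^+ 4 * (y ^+ 3 + y ^+ 4).
  move=> uS du; rewrite branchE card_closed_nbhd1 // du mulrC ler_pM2l ?exprn_gt0 //.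
  have [a aN] : exists a, a \in neighbors e u :&: S by apply/card_gt0P; rewrite du.
  move: (aN); rewrite !inE => /andP[eua aS].
  have da := cubicN u a uS du aN.
  have [w wN wu] : exists2 w, w \in neighbors e a :&: S & w != u.
    have := min3 a aS; rewrite (cardsD1 u) !inE (edge_sym e_simple) eua uS /= add1n ltnS.
    by move=> /ltnW/card_gt0P[w]; rewrite !inE => /andP[wu wN]; exists w; rewrite ?inE.
  move: (wN); rewrite !inE => /andP[eaw wS].
  have dw := cubicN a w aS da wN.
  have aC : a \in closed_nbhd e [set u] by apply: mem_closed_nbhd eua; rewrite set11.
  apply: (@weight_low_degree _ w).
  - move=> S' ltS'; apply: IH; apply: leq_trans ltS' (subset_leq_card (subsetDl _ _)).
  - rewrite in_setD wS andbT in_closed_nbhd in_set1 (negbTE wu) /=.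
    apply/exists_inP => -[_ /set1P-> euw].
    have wNu : w \in neighbors e u :&: S by rewrite !inE euw.
    by have := indN u a w uS du aN wNu; rewrite eaw.
  - rewrite -ltnS -dw; apply: proper_card; apply/properP; split.
      by apply: setIS; apply: subsetDl.
    exists a; first by rewrite !inE (edge_sym e_simple) eaw.
    by rewrite in_setI in_setD aC andbF.
have := weight_double_count vS.
have : \sum_(u in neighbors e v :&: S) branch S [set u]
    <= (y ^+ 4 * (y ^+ 3 + y ^+ 4)) *+ 3.
  rewrite -[X in _ *+ X]dv -sumr_const; apply: ler_sum => u uN; apply: branch_cubic.
    by move: uN; rewrite in_setI => /andP[].
  exact: (cubicN v).
have := branch_cubic v vS dv; have := cubic_numeric y_gt0 y5.
rewrite -mulr_natr; move: (y ^+ 4 * _) => z; lra.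
Qed.

Theorem weight_le1 S : weight S <= 1.
Proof.
have [n] := ubnP #|S|; elim: n S => // n IHn S; rewrite ltnS => leSn.
have IH : smaller_weights_le1 S by move=> S' lt; apply: IHn; apply: leq_trans lt leSn.
have [S0|/set0Pn[v0 v0S]] := eqVneq S finset.set0.
  rewrite /weight S0 cards0 expr0 mulr1 lern1.
  apply: (@leq_trans #|[set (finset.set0 : {set T})]|); last by rewrite cards1.
  by apply/subset_leq_card/subsetP => D /dis_inP[]; rewrite subset0 inE.
case: (arg_minnP (fun v => deg S v) v0S) => v vS min_v.
have [low|] := leqP (deg S v) 2.
  apply: le_trans (weight_low_degree IH vS low) _.
  by have [] := low_degree_numeric y_gt0 y5.
rewrite leq_eqVlt => /orP[/eqP/esym dv|high].
  by apply: (weight_cubic IH _ vS dv) => u /min_v; rewrite dv.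
have branch_min u : u \in S -> branch S [set u] <= y ^+ (deg S v).+1.
  by move=> uS; apply: branch1_le => //; apply: min_v.
have := weight_double_count vS.
have : \sum_(u in neighbors e v :&: S) branch S [set u]
    <= y ^+ (deg S v).+1 *+ deg S v.
  rewrite -sumr_const; apply: ler_sum => u; rewrite in_setI => /andP[_].
  exact: branch_min.
have := branch_min v vS; have := high_degree_numeric y_gt0 y5 high.
rewrite -addn2 natrD mulrDl -mulr_natl; lra.
Qed.

End UpperBound.

(** * Constructions: disjoint unions and rook graphs *)

Section Extremal.

Import mathcomp.boot.fintype mathcomp.boot.finset.

Lemma kDISP (T : finType) (e : rel T) k (D : {set T}) :
  reflect ((forall x y, x \in D -> y \in D -> ~~ e x y) /\
           (forall v, v \notin D -> (k <= #|neighbors e v :&: D|)%N))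
          (kDIS e k D).
Proof.
apply: (iffP andP) => -[indD domD]; split.
- by move=> x y xD yD; move/forall_inP/(_ x xD)/forall_inP: indD; apply.
- by move=> v vD; move/forallP/(_ v)/implyP: domD; apply.
- by apply/forall_inP => x xD; apply/forall_inP => y yD; apply: indD.
- by apply/forallP => v; apply/implyP/domD.
Qed.

Lemma simple_graphP (T : finType) (e : rel T) :
  reflect ((forall x, ~~ e x x) /\ forall x y, e x y = e y x) (simple_graph e).
Proof.
apply: (iffP andP) => -[irr sym]; split.
- exact/forallP.
- by move=> x y; apply/eqP; move/forallP/(_ x)/forallP: sym.
- exact/forallP.
- by apply/forallP => x; apply/forallP => y; rewrite sym.
Qed.

(** Allows graphs to be built on any finite vertex type, such as sums and products. *)
Lemma num_kDIS_le_mi (T : finType) (e : rel T) k :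
  simple_graph e -> (num_kDIS e k <= mi k #|T|)%N.
Proof.
move=> /simple_graphP[irr sym].
pose E := [set p : 'I_#|T| * 'I_#|T| | e (enum_val p.1) (enum_val p.2)].
have relE i j : rel_of_pairs E i j = e (enum_val i) (enum_val j) by rewrite /rel_of_pairs inE.
apply: leq_trans (leq_bigmax_cond E _); last first.
  by apply/simple_graphP; split=> [x|x y]; rewrite !relE.
pose transfer (D : {set T}) := [set i : 'I_#|T| | enum_val i \in D].
rewrite /num_kDIS -(@card_imset _ _ transfer); last first.
  move=> D1 D2 /setP eqD; apply/setP => x.
  by have := eqD (enum_rank x); rewrite !inE enum_rankK.
apply/subset_leq_card/subsetP => _ /imsetP[D + ->]; rewrite !inE => /kDISP[indD domD].
apply/kDISP; split=> [x y|v]; rewrite !inE.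
  by rewrite relE; apply: indD.
move=> /domD; rewrite -(@on_card_preimset _ _ (@enum_val T T)); last first.
  exact/onW_bij/enum_val_bij.
by congr (_ <= _)%N; apply: eq_card => w; rewrite !inE relE.
Qed.

Lemma mi_attained k n :
  exists2 e : rel 'I_n, simple_graph e & num_kDIS e k = mi k n.
Proof.
have [|E simpleE eqE] := @eq_bigmax_cond _
    [pred E : {set 'I_n * 'I_n} | simple_graph (rel_of_pairs E)]
    (fun E => num_kDIS (rel_of_pairs E) k).
  apply/card_gt0P; exists finset.set0; apply/simple_graphP.
  by split=> [x|x y]; rewrite /rel_of_pairs !inE.
by exists (rel_of_pairs E).
Qed.

Lemma mi_gt0 k n : (0 < mi k n)%N.
Proof.
have simple0 : simple_graph (fun _ _ : 'I_n => false) by apply/simple_graphP.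
have := num_kDIS_le_mi k simple0; rewrite card_ord; apply: leq_trans.
apply/card_gt0P; exists [set: 'I_n]; rewrite inE; apply/kDISP.
by split=> // v; rewrite inE.
Qed.

Definition disjoint_union (T1 T2 : finType) (e1 : rel T1) (e2 : rel T2) :
    rel (T1 + T2) :=
  fun x y => match x, y with
             | inl a, inl b => e1 a b
             | inr a, inr b => e2 a b
             | _, _ => false
             end.

Definition union_set (T1 T2 : finType) (D : {set T1} * {set T2}) : {set T1 + T2} :=
  [set z | match z with inl a => a \in D.1 | inr b => b \in D.2 end].

Lemma num_kDIS_disjoint_union (T1 T2 : finType) (e1 : rel T1) (e2 : rel T2) k :
  (num_kDIS e1 k * num_kDIS e2 k <= num_kDIS (disjoint_union e1 e2) k)%N.
Proof.
rewrite /num_kDIS -cardsX -(@card_imset _ _ (@union_set T1 T2)); last first.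
  move=> [D1 D2] [D1' D2'] /setP eqD; congr (_, _); apply/setP => z.
    by have := eqD (inl z); rewrite !inE.
  by have := eqD (inr z); rewrite !inE.
apply/subset_leq_card/subsetP => _ /imsetP[[D1 D2] + ->].
rewrite !inE /= => /andP[/kDISP[ind1 dom1] /kDISP[ind2 dom2]].
apply/kDISP; split=> [[x|x] [y|y]|[v|v]]; rewrite !inE //=.
- exact: ind1.
- exact: ind2.
- move=> /dom1/leq_trans; apply; rewrite -(card_imset _ (@inl_inj T1 T2)).
  by apply/subset_leq_card/subsetP => _ /imsetP[w + ->]; rewrite !inE.
- move=> /dom2/leq_trans; apply; rewrite -(card_imset _ (@inr_inj T1 T2)).
  by apply/subset_leq_card/subsetP => _ /imsetP[w + ->]; rewrite !inE.
Qed.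

Lemma mi_supermul k m n : (mi k m * mi k n <= mi k (m + n))%N.
Proof.
have [e1 /simple_graphP[irr1 sym1] <-] := mi_attained k m.
have [e2 /simple_graphP[irr2 sym2] <-] := mi_attained k n.
apply: leq_trans (num_kDIS_disjoint_union e1 e2 k) _.
have <- : #|{: 'I_m + 'I_n}| = (m + n)%N by rewrite card_sum !card_ord.
apply: num_kDIS_le_mi.
by apply/simple_graphP; split=> [[x|x]|[x|x] [y|y]] /=.
Qed.

Definition rook (T : finType) : rel (T * T) :=
  fun p q => (p != q) && ((p.1 == q.1) || (p.2 == q.2)).

(** The graph of a permutation [s] is a placement of non-attacking rooks.  A square
[(i, j)] off it sees the rook of its row, [(i, s i)], and the rook of its column,
[(s^-1 j, j)], and these differ. *)
Lemma num_kDIS_rook n : (n`! <= num_kDIS (@rook 'I_n) 2)%N.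
Proof.
pose graph (s : 'S_n) := [set p : 'I_n * 'I_n | p.2 == s p.1].
rewrite -card_Sn -cardsT -(@card_imset _ _ graph); last first.
  move=> s t /setP eqst; apply/permP => i.
  by have := eqst (i, s i); rewrite !inE /= eqxx => /esym/eqP.
apply/subset_leq_card/subsetP => _ /imsetP[s _ ->].
rewrite inE; apply/kDISP; split=> [[i j] [i' j']|[i j]]; rewrite !inE /=.
  move=> /eqP-> /eqP->; rewrite /rook /= (inj_eq perm_inj) orbb.
  by rewrite -pair_eqE /=; apply/negP => /andP[+ /eqP ii']; rewrite ii' !eqxx.
move=> j_si.
have neq : (i, s i) != ((s^-1)%g j, j).
  by rewrite xpair_eqE; apply: contraNN j_si => /andP[_ /eqP->].
rewrite (_ : 2%N = #|[set (i, s i); ((s^-1)%g j, j)]|); last by rewrite cards2 neq.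
apply/subset_leq_card/subsetP => _ /set2P[] ->;
  rewrite !inE /rook /= ?eqxx ?permKV ?eqxx ?orbT ?andbT.
  by rewrite xpair_eqE eqxx.
rewrite xpair_eqE eqxx andbT.
by apply: contraNN j_si => /eqP->; rewrite permKV.
Qed.

Lemma factorial_le_mi2 n : (n`! <= mi 2 (n * n))%N.
Proof.
apply: leq_trans (num_kDIS_rook n) _.
have <- : #|{: 'I_n * 'I_n}| = (n * n)%N by rewrite card_prod card_ord.
apply: num_kDIS_le_mi.
apply/simple_graphP; rewrite /rook; split=> [x|x y]; first by rewrite eqxx.
by rewrite eq_sym [y.1 == _]eq_sym [y.2 == _]eq_sym.
Qed.

Lemma mi2_le (R : realFieldType) (y : R) n :
  0 < y -> 3 * y ^+ 5 = 1 -> (mi 2 n)%:R * y ^+ n <= 1.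
Proof.
move=> y_gt0 y5; have [e simple_e <-] := mi_attained 2 n.
have := weight_le1 y_gt0 y5 simple_e [set: 'I_n].
by rewrite /weight cardsT card_ord num_kDIS_dis_in.
Qed.

End Extremal.

(** * Limits of superadditive sequences *)

Local Open Scope classical_set_scope.

Section Fekete.

Context (R : realType) (a : nat -> R) (C : R)
  (a_superadd : forall m n, a m + a n <= a (m + n)%N)
  (a_ge0 : forall n, 0 <= a n) (a_le : forall n, a n <= C * n%:R).

Let slopes : set R := [set a n / n%:R | n in [set n | (0 < n)%N]].

Lemma superadditive_muln q m : q%:R * a m <= a (q * m)%N.
Proof.
elim: q => [|q IHq]; first by rewrite mul0r.
by apply: le_trans (a_superadd _ _); rewrite -natr1 mulrDl mul1r addrC lerD2l.
Qed.

(** Divide [n] by [m]: the quotient exceeds [n / m - 1], and the remainder contributes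
a nonnegative amount. *)
Lemma superadditive_slope m n :
  (0 < m)%N -> (0 < n)%N -> a m / m%:R - a m / n%:R <= a n / n%:R.
Proof.
move=> m_gt0 n_gt0.
have m_gt0R : 0 < m%:R :> R by rewrite ltr0n.
have n_gt0R : 0 < n%:R :> R by rewrite ltr0n.
have an : (n %/ m)%:R * a m <= a n.
  apply: le_trans (superadditive_muln _ _) _.
  rewrite {2}(divn_eq n m); apply: le_trans (a_superadd _ _).
  by rewrite lerDl.
have nm : n%:R <= (n %/ m)%:R * m%:R + m%:R :> R.
  by rewrite {1}(divn_eq n m) natrD natrM lerD2l ler_nat ltnW // ltn_mod.
rewrite ler_pdivlMr // mulrBl divfK ?gt_eqF //.
apply: le_trans an; rewrite lerBlDr mulrAC ler_pdivrMr //.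
have -> : ((n %/ m)%:R * a m + a m) * m%:R = a m * ((n %/ m)%:R * m%:R + m%:R) by ring.
exact: ler_wpM2l.
Qed.

(** The limit is the supremum of the slopes: once some slope [a m / m] is close to
it, [superadditive_slope] keeps all later slopes close, as [a m / n] tends to 0. *)
Lemma fekete :
  exists l, [/\ a n / n%:R @[n --> \oo] --> l,
    forall n, (0 < n)%N -> a n / n%:R <= l & l <= C].
Proof.
have slopes0 : slopes !=set0 by exists (a 1 / 1%:R); exists 1%N.
have slopesC : ubound slopes C.
  by move=> _ [n n_gt0 <-]; rewrite ler_pdivrMr ?ltr0n.
have sup_slopes : has_sup slopes by split => //; exists C.
have le_sup n : (0 < n)%N -> a n / n%:R <= sup slopes.
  by move=> n_gt0; apply: ub_le_sup; [exists C | exists n].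
exists (sup slopes); split => //; last exact: ge_sup.
apply/cvgrPdist_le => eps eps_gt0.
have [_ [m m_gt0 <-] m_eps] := sup_adherent (divr_gt0 eps_gt0 (ltr0n R 2)) sup_slopes.
near=> n.
have n_gt0 : (0 < n)%N by near: n; exists 1%N.
have := le_sup n n_gt0; have := superadditive_slope m_gt0 n_gt0.
have : a m / n%:R <= eps / 2.
  rewrite ler_pdivrMr ?ltr0n // -ler_pdivrMl ?divr_gt0 //.
  by near: n; apply: nbhs_infty_ger.
move=> small_n slope_n sup_n; rewrite ger0_norm ?subr_ge0 //; lra.
Unshelve. all: by end_near.
Qed.

End Fekete.

(** * The limit of zeta *)

Section Zeta.

Context (R : realType).

Lemma nth_rootK n (x : R) : (0 < n)%N -> 0 <= x -> nth_root n x ^+ n = x.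
Proof.
move=> n_gt0 x_ge0; rewrite /nth_root -powR_mulrn ?powR_ge0 //.
by rewrite -powRrM mulVf ?powRr1 // pnatr_eq0 -lt0n.
Qed.

Lemma zetaE k n : zeta R k n = expR (ln (mi k n)%:R / n%:R).
Proof.
by rewrite /zeta /nth_root /powR pnatr_eq0 eqn0Ngt mi_gt0 mulrC.
Qed.

(** Fekete's lemma for [ln (mi k n)], transported by the exponential. *)
Lemma zeta_cvg_sup k (c : R) :
  0 < c -> (forall n, (mi k n)%:R <= c ^+ n) ->
  exists l, [/\ zeta R k n @[n --> \oo] --> l,
    forall n, (0 < n)%N -> zeta R k n <= l & l <= c].
Proof.
move=> c_gt0 mi_c.
have mi_gt0R n : 0 < (mi k n)%:R :> R by rewrite ltr0n mi_gt0.
have [m n|n|n|l [cvg_l le_l l_c]] := @fekete R (fun n => ln (mi k n)%:R) (ln c).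
- rewrite -lnM ?posrE // ler_ln ?posrE ?mulr_gt0 //.
  by rewrite -natrM ler_nat mi_supermul.
- by apply: ln_ge0; rewrite ler1n mi_gt0.
- by rewrite mulr_natr -lnXn // ler_ln ?posrE ?exprn_gt0.
exists (expR l); split.
- rewrite (_ : zeta R k = fun n => expR (ln (mi k n)%:R / n%:R)); last first.
    by apply/funext => n; apply: zetaE.
  by apply: continuous_cvg => //; apply: continuous_expR.
- by move=> n n_gt0; rewrite zetaE ler_expR le_l.
- by rewrite -[leRHS]lnK ?posrE // ler_expR.
Qed.

End Zeta.

Theorem theorem1p6 (R : realType) :
  cvgn (zeta R 2) /\
  [/\ (122 / 100 : R) < nth_root 9 6,
      nth_root 9 6 <= limn (zeta R 2),
      limn (zeta R 2) <= nth_root 5 3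
    & nth_root 5 3 < (1246 / 1000 : R)].
Proof.
have x5 := @nth_rootK R 5 3 isT (ler0n R 3).
have x9 := @nth_rootK R 9 6 isT (ler0n R 6).
have x_gt0 : 0 < nth_root 5 3 :> R by rewrite powR_gt0 ?ltr0n.
have z_gt0 : 0 < nth_root 9 6 :> R by rewrite powR_gt0 ?ltr0n.
have lower : 122 / 100 < nth_root 9 6 :> R.
  rewrite ltNge; apply/negP => le_root.
  have : nth_root 9 6 ^+ 9 <= (122 / 100) ^+ 9 :> R.
    by apply: lerXn2r le_root; rewrite nnegrE; lra.
  by rewrite x9; lra.
have upper : nth_root 5 3 < 1246 / 1000 :> R.
  rewrite ltNge; apply/negP => le_root.
  have : (1246 / 1000) ^+ 5 <= nth_root 5 3 ^+ 5 :> R.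
    by apply: lerXn2r le_root; rewrite nnegrE; lra.
  by rewrite x5; lra.
have mi2_growth n : (mi 2 n)%:R <= nth_root 5 3 ^+ n :> R.
  rewrite -[leRHS]mul1r -ler_pdivrMr ?exprn_gt0 // -exprVn; apply: mi2_le; rewrite ?invr_gt0 //.
  by rewrite exprVn x5 divff // pnatr_eq0.
have [l [cvg_l le_l l_x]] := zeta_cvg_sup x_gt0 mi2_growth.
split; first exact: cvgP cvg_l.
have -> : limn (zeta R 2) = l by apply/cvg_lim.
split => //; apply: le_trans (le_l 9 isT).
(* The [3 x 3] rook graph has [3! = 6] permutation placements. *)
apply: ge0_ler_powR; rewrite ?nnegrE ?invr_ge0 ?ler0n // ler_nat.
exact: (factorial_le_mi2 3).
Qed.
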